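(* Let $n\ge 1$. (i) Let $\tau=\tau(n)\in\mathbb{R}_{>0}$ be a constant depending on $n$ such that for every $o$-symmetric convex body $K\subset\mathbb{R}^n$ there exists a GAP $\mathrm{P}(A,b)\subseteq K$ with $K\cap\mathbb{Z}^n\subseteq \mathrm{P}(A,\tau\,b)$. Then $$\tau\ge (n!)^{1/n}>\frac{1}{\mathrm{e}}\,n.$$ (ii) Let $\nu=\nu(n)\in\mathbb{R}_{>0}$ be a constant depending on $n$ such that for every $o$-symmetric convex body $K\subset\mathbb{R}^n$ there exists a GAP $\mathrm{P}(A,b)\subseteq K$ with $|K\cap\mathbb{Z}^n|\le \nu\,|\mathrm{P}(A,b)|$. Then $$\nu\ge \frac{2^n+1}{3}.$$
   Context: An $o$-symmetric convex body in $\mathbb{R}^n$ is a compact convex set $K\subset\mathbb{R}^n$ with non-empty interior and $K=-K$. A (symmetric) generalized arithmetic progression (with respect to $\mathbb{Z}^n$), GAP for short, is a set of the form $$\mathrm{P}(A,b)=\{A z : z\in\mathbb{Z}^n,\ -b_i\le z_i\le b_i,\ 1\le i\le n\},$$ where $A\in\mathbb{Z}^{n\times n}$ with $\det A\neq 0$, and $b\in\mathbb{R}^n_{>0}$ (positive entries, not necessarily integers). $|\cdot|$ applied to a finite set denotes its cardinality, and $\mathrm{e}$ is Euler's number. *)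

(* Defs.v *)
From HB Require Import structures.
From mathcomp Require Import all_boot all_order all_algebra.
From mathcomp Require Import finmap.
From mathcomp Require Import all_classical all_reals all_analysis.

Set Implicit Arguments.
Unset Strict Implicit.
Unset Printing Implicit Defensive.

Import Order.TTheory GRing.Theory Num.Theory.
Import numFieldNormedType.Exports.

Local Open Scope classical_set_scope.
Local Open Scope ring_scope.

Definition sym_convex_body (R : realType) (n : nat) (K : set 'cV[R]_n) : Prop :=
  [/\ compact K, convex_set K, K° !=set0 & K = [set - x | x in K]].

Definition int_points (R : realType) (n : nat) : set 'cV[R]_n :=
  [set map_mx intr z | z in [set: 'cV[int]_n]].

Arguments int_points : clear implicits.

Definition gap_params (R : realType) (n : nat) (A : 'M[int]_n) (b : 'cV[R]_n) :
    Prop :=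
  \det A != 0 /\ forall i, 0 < b i 0.

Definition gap (R : realType) (n : nat) (A : 'M[int]_n) (b : 'cV[R]_n) :
    set 'cV[R]_n :=
  [set map_mx intr (A *m z) |
    z in [set z : 'cV[int]_n | forall i, - b i 0 <= (z i 0)%:~R <= b i 0]].

(* [fset_set S] is the empty finite set when [S] is infinite, so this is the
   cardinality only for finite [S]. It is applied to [K `&` int_points R n] with
   [K] compact and to [gap A b], both of which are finite. *)
Definition card_points (R : realType) (n : nat) (S : set 'cV[R]_n) : nat :=
  #|` fset_set S|%fset.

(* Main.v *)
Require Import Defs.
From HB Require Import structures.
From mathcomp Require Import all_boot all_order all_algebra.
From mathcomp Require Import finmap.
From mathcomp Require Import all_classical all_reals all_analysis.
From mathcomp Require Import ring lra zify.

Import Order.TTheory GRing.Theory Num.Theory.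
Import numFieldNormedType.Exports.

Local Open Scope classical_set_scope.
Local Open Scope ring_scope.

(** Each part is witnessed by explicit polytopes with few inscribed
progressions.

For the constant tau, take the cross-polytope K of radius m and let m grow.
Covering the lattice points of K forces the integer matrix A to be invertible
over the integers, since the standard basis vectors are covered.  Then every row
of the inverse of A has a nonzero entry, which is at least 1 in absolute value,
so covering the points m e_j forces m <= tau b_i for every i
([gap_cover_crosspolytope]).  In the other direction, put k = floor (m / tau), so
that k <= b_i for every i and P(A, b) contains k A eps for every sign vector eps.
The average over eps of the absolute value of the j-th coordinate of A eps is at
least that of every entry of row j of A, hence at least 1 ([sum_signs_ge]).  So
some A eps has l1-norm at least n, and k A eps in K yields n k <= m
([gap_sub_crosspolytope]).  As m tends to infinity this gives n <= tau, and
n! <= n ^ n turns it into the stated bound.  The comparison of the root of n!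
with n / e is n ^ n < e ^ n n!, by induction from (1 + 1 / n) ^ n <= e.

For the constant nu, take the convex hull of {0, 1}^(n-1) x {1} and its
reflection, where the distinguished coordinate is numbered 0 below.  Its section
at height 0 is the cube of side 1 around the origin, so its lattice points are the
2 ^ n vertices and the origin.  Every nonzero lattice point has height 1 or -1,
so of two such points u and v one of u + v, u - v has height 0 and cannot be
another nonzero point of the body, and 2 u is too high.  Hence a progression
inside the body is contained in {0, u, -u} ([card_gap_skew_cube]), and
2 ^ n + 1 <= 3 nu. *)

(** * Symmetric polytopes are convex bodies *)

Definition polytope {R : realType} {n : nat} {I : finType}
    (L : I -> 'I_n -> R) (c : R) : set 'cV[R]_n :=
  [set v | forall k, `|\sum_i L k i * v i 0| <= c].

(** Everything but boundedness is automatic: the constraints are finitely many,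
closed, convex and symmetric, and all of them hold strictly near the origin. *)
Lemma polytope_sym_convex_body (R : realType) (n : nat) (I : finType)
    (L : I -> 'I_n -> R) (c B : R) : 0 < c ->
  (forall v, polytope L c v -> forall i, `|v i 0| <= B) ->
  sym_convex_body (polytope L c).
Proof.
move=> c0 bounded; split.
- have tr_cont : continuous (fun w : 'rV[R]_n => w^T : 'cV[R]_n).
    move=> w s /= /nbhs_ballP[e e0 es].
    apply/nbhs_ballP; exists e => //= w' [_ ww']; apply: es; split=> // i j.
    by rewrite !mxE; exact: ww'.
  have form_cont k : continuous (fun v : 'cV[R]_n => \sum_i L k i * v i 0 : R).
    have -> : (fun v : 'cV[R]_n => \sum_i L k i * v i 0) =
        \sum_i (fun v : 'cV[R]_n => L k i * v i 0 : R).
      by apply/funext => v; rewrite fct_sumE.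
    apply: (big_ind (fun f : 'cV[R]_n -> R => continuous f)).
    + exact: (@cst_continuous _ _ (0 : R)).
    + by move=> f g fc gc v; exact: (cvgD (fc v) (gc v)).
    + move=> i _ v; apply: (@continuousM _ _ (fun=> L k i)).
        exact: cst_continuous.
      exact: coord_continuous.
  (* A closed subset of the transpose of a compact box of row vectors. *)
  apply: (@subclosed_compact _ (polytope L c)
    ((fun w : 'rV[R]_n => w^T : 'cV[R]_n) @`
      [set w : 'rV[R]_n | forall i, `[-B, B]%classic (w ord0 i)])).
  + rewrite (_ : polytope L c = \bigcap_k
      ((fun v : 'cV[R]_n => `|\sum_i L k i * v i 0|) @^-1` [set x | x <= c])).
      apply: closed_bigI => k _.
      apply: closed_comp; last exact: closed_le.
      by move=> v _; exact: (cvg_norm (form_cont k v)).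
    by apply/seteqP; split=> [v Kv k _ //|v Kv k]; exact: Kv.
  + apply: continuous_compact; first exact: continuous_subspaceT.
    apply: (@rV_compact _ _ (fun=> `[-B, B]%classic)) => _.
    exact: segment_compact.
  + move=> v /bounded vB; exists v^T; last exact: trmxK.
    by move=> i /=; rewrite mxE in_itv /= -ler_norml.
- move=> x y t; rewrite !inE => Kx Ky k.
  rewrite (_ : \sum_i _ = t%:num * (\sum_i L k i * x i 0) +
      (1 - t%:num) * (\sum_i L k i * y i 0)); last first.
    rewrite !mulr_sumr -big_split; apply: eq_bigr => i _.
    by rewrite !mxE /= /unstable.onem; move: (t%:num : R) => s; ring.
  have t0 : 0 <= t%:num by [].
  have t1 : 0 <= 1 - t%:num by rewrite subr_ge0.
  rewrite (le_trans (ler_normD _ _))// !normrM (ger0_norm t0) (ger0_norm t1).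
  by have := ler_wpM2l t0 (Kx k); have := ler_wpM2l t1 (Ky k); lra.
- (* On the ball of radius c / M every form is at most c; the summand 1 keeps M
     positive when all the forms vanish. *)
  pose M := 1 + \sum_k \sum_i `|L k i|.
  have M0 : 0 < M by rewrite ltr_pwDl// sumr_ge0// => k _; exact: sumr_ge0.
  exists 0; apply/nbhs_ballP; exists (c / M); first exact: divr_gt0.
  move=> v [_ /= v_small] k.
  rewrite (le_trans (ler_norm_sum _ _ _))//.
  apply: (@le_trans _ _ ((\sum_i `|L k i|) * (c / M))).
    rewrite mulr_suml ler_sum// => i _; rewrite normrM ler_wpM2l//.
    by have := v_small i 0; rewrite /ball /= mxE sub0r normrN => /ltW.
  rewrite mulrCA ger_pMr// ler_pdivrMr// mul1r.
  rewrite /M (bigD1 k)//= addrCA lerDl addr_ge0//.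
  by apply: sumr_ge0 => j _; exact: sumr_ge0.
- have polyN v : polytope L c v -> polytope L c (- v).
    move=> Kv k; rewrite (eq_bigr (fun i => - (L k i * v i 0))).
      by rewrite sumrN normrN; exact: Kv.
    by move=> i _; rewrite mxE mulrN.
  apply/seteqP; split=> [v Kv|_ [v Kv <-]]; last exact: polyN.
  by exists (- v); [exact: polyN|rewrite opprK].
Qed.

(** * Comparison of n! with powers of n *)

Lemma fact_le_expn n : (n`! <= n ^ n)%N.
Proof.
elim: n => // n IH; rewrite factS expnS leq_mul2l /=.
by case: n IH => // n IH; rewrite (leq_trans IH)// leq_exp2r.
Qed.

(** The quotient of two consecutive values of n ^ n / n! is (1 + 1 / n) ^ n, which
is at most e; strictness comes from the base case 1 < e. *)
Lemma expn_lt_expR_fact (R : realType) n : (0 < n)%N ->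
  (n%:R : R) ^+ n < expR 1 ^+ n * n`!%:R.
Proof.
case: n => // n _; elim: n => [|n IH].
  by rewrite !expr1 mulr1 expR_gt1.
have step : (n.+2%:R : R) ^+ n.+1 <= expR 1 * n.+1%:R ^+ n.+1.
  have -> : (n.+2%:R : R) = (1 + n.+1%:R^-1) * n.+1%:R.
    by rewrite mulrDl mul1r mulVf ?pnatr_eq0// natr1.
  rewrite exprMn ler_wpM2r ?exprn_ge0 ?ler0n//.
  (* Write e as (e ^ (1 / n)) ^ n and use 1 + x <= e ^ x. *)
  rewrite -[X in expR X](@mulfV _ (n.+1%:R : R)) ?pnatr_eq0// expRM_natl.
  by rewrite lerXn2r ?nnegrE ?addr_ge0 ?expR_ge0 ?invr_ge0 ?ler0n ?expR_ge1Dx.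
rewrite exprS factS natrM [expR 1 ^+ _]exprS.
rewrite [ltRHS](_ : _ =
  n.+2%:R * (expR 1 * (expR 1 ^+ n.+1 * n.+1`!%:R))); last by ring.
by rewrite ltr_pM2l ?ltr0n// (le_lt_trans step)// ltr_pM2l ?expR_gt0.
Qed.

Lemma powR_exprn_inv (R : realType) n (x : R) : (0 < n)%N -> 0 <= x ->
  (x ^+ n) `^ (n%:R^-1) = x.
Proof.
move=> n0 x0; rewrite -powR_mulrn// -powRrM mulfV ?powRr1//.
by rewrite pnatr_eq0 -lt0n.
Qed.

Lemma root_fact_le (R : realType) n : (0 < n)%N ->
  (n`!%:R : R) `^ (n%:R^-1) <= n%:R.
Proof.
move=> n0; rewrite -[leRHS](@powR_exprn_inv R n)//.
apply: ge0_ler_powR; rewrite ?invr_ge0 ?nnegrE ?exprn_ge0//.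
by rewrite -natrX ler_nat fact_le_expn.
Qed.

Lemma lt_root_fact (R : realType) n : (0 < n)%N ->
  (expR 1)^-1 * n%:R < (n`!%:R : R) `^ (n%:R^-1).
Proof.
move=> n0; have e0 : 0 <= (expR 1)^-1 * n%:R :> R.
  by rewrite mulr_ge0// invr_ge0 expR_ge0.
rewrite -[ltLHS](@powR_exprn_inv R n)//.
apply: gt0_ltr_powR; rewrite ?invr_gt0 ?nnegrE ?exprn_ge0 ?ltr0n//.
by rewrite exprMn exprVn ltr_pdivrMl ?exprn_gt0 ?expR_gt0// expn_lt_expR_fact.
Qed.

(** * Averaging over sign vectors *)

(** Changing the k-th sign turns r + c k into r - c k, and the absolute values of
these two numbers add up to at least twice that of c k. *)
Lemma sum_signs_ge (R : realDomainType) n (c : 'I_n -> R) k :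
  2 ^+ n * `|c k| <=
  \sum_(eps : {ffun 'I_n -> bool}) `|\sum_i (-1) ^+ eps i * c i|.
Proof.
pose flip (eps : {ffun 'I_n -> bool}) := [ffun i => (i == k) (+) eps i].
have flipK : involutive flip.
  by move=> eps; apply/ffunP => i; rewrite !ffunE addbA addbb.
have pair (eps : {ffun 'I_n -> bool}) : 2 * `|c k| <=
    `|\sum_i (-1) ^+ eps i * c i| + `|\sum_i (-1) ^+ (flip eps) i * c i|.
  rewrite (le_trans _ (ler_normB _ _))// -sumrB (bigD1 k)//= big1.
    rewrite addr0 ffunE eqxx signrN mulNr opprK -mulr2n normrMn normrM normrX.
    by rewrite normrN1 expr1n mul1r mulr_natl.
  by move=> i /negbTE ik; rewrite ffunE ik subrr.
rewrite -(@ler_pM2l _ 2)// [leRHS]mulr_natl [leRHS]mulr2n.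
rewrite [X in _ <= _ + X](reindex_inj (inv_inj flipK)) -big_split /=.
apply: le_trans (ler_sum _ (fun eps _ => pair eps)).
rewrite sumr_const card_ffun card_bool card_ord -[leRHS]mulr_natl natrX.
by rewrite mulrCA.
Qed.

Lemma row_neq0 (R : comNzRingType) n (A : 'M[R]_n) i :
  \det A != 0 -> exists j, A i j != 0.
Proof.
move=> detA; apply/existsP; apply: contraNT detA.
rewrite negb_exists => /forallP A0; rewrite (expand_det_row A i).
by rewrite big1// => j _; have /negPn/eqP-> := A0 j; rewrite mul0r.
Qed.

(** A nonsingular integer matrix has a nonzero entry in every row, so on average
over the sign vectors each of the n coordinates contributes at least 1 to the
l1-norm. *)
Lemma exists_signs_norm_ge n (A : 'M[int]_n) : \det A != 0 ->
  exists eps : {ffun 'I_n -> bool},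
    n%:R <= \sum_j `|\sum_i (-1) ^+ eps i * A j i|.
Proof.
move=> detA; apply/existsP; apply: contraT.
rewrite negb_exists => /forallP small.
suff : 2 ^+ n * n%:R < 2 ^+ n * n%:R :> int by rewrite ltxx.
apply: (@le_lt_trans _ _ (\sum_(eps : {ffun 'I_n -> bool})
    \sum_j `|\sum_i (-1) ^+ eps i * A j i|)).
  rewrite exchange_big /= mulr_natr -[X in _ *+ X]card_ord -sumr_const.
  apply: ler_sum => j _; have [i Aji] := row_neq0 _ _ _ j detA.
  apply: le_trans (sum_signs_ge _ _ _ i).
  by rewrite ler_peMr ?exprn_ge0// -gtz0_ge1 normr_gt0.
rewrite (_ : 2 ^+ n * n%:R = \sum_(eps : {ffun 'I_n -> bool}) n%:R); last first.
  by rewrite sumr_const card_ffun card_bool card_ord -natrX mulr_natl.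
apply: ltr_sum; last by move=> eps _; rewrite ltNge small.
by apply/hasP; exists [ffun=> true]; rewrite ?mem_index_enum.
Qed.

(** * Progressions in the cross-polytope *)

Definition sign_form (R : realType) n (eps : {ffun 'I_n -> bool})
    (i : 'I_n) : R :=
  (-1) ^+ eps i.

(** The l1-norm is the maximum of the linear forms with coefficients 1 and -1, so
this is its ball of radius m; the description by linear forms makes it a
[polytope]. *)
Definition crosspolytope (R : realType) n (m : nat) : set 'cV[R]_n :=
  polytope (@sign_form R n) m%:R.

Lemma crosspolytope_sym_convex_body (R : realType) n m : (0 < m)%N ->
  sym_convex_body (crosspolytope R n m).
Proof.
move=> m0; apply: (@polytope_sym_convex_body _ _ _ _ _ m%:R).
  by rewrite ltr0n.
move=> v Kv i; rewrite -(@ler_pM2l _ (2 ^+ n)) ?exprn_gt0//.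
apply: le_trans (@sum_signs_ge _ _ (fun j => v j 0) i) _.
apply: le_trans (ler_sum _ (fun eps _ => Kv eps)) _.
by rewrite sumr_const card_ffun card_bool card_ord -natrX mulr_natl.
Qed.

Lemma map_intr_inj (R : realType) n :
  injective (map_mx intr : 'cV[int]_n -> 'cV[R]_n).
Proof.
move=> x y /matrixP xy; apply/matrixP => i j.
by have := xy i j; rewrite !mxE; exact: intr_inj.
Qed.

Lemma axis_points_crosspolytope (R : realType) n (m k : nat) (j : 'I_n) :
  (k <= m)%N ->
  (crosspolytope R n m `&` int_points R n)
    (map_mx intr (k%:Z *: delta_mx j 0)).
Proof.
move=> km; split=> [eps|]; last by exists (k%:Z *: delta_mx j 0).
rewrite (bigD1 j)//= big1 => [|i /negbTE ij].
  rewrite addr0 !mxE !eqxx mulr1 normrM normrX normrN1 expr1n mul1r.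
  by rewrite pmulrn normr_nat ler_nat.
by rewrite !mxE ij /= mulr0 mulr0.
Qed.

(** Covering the basis vectors produces an integer right inverse Z of A.  The
coordinates of m e_j in the basis of the columns of A are then m times the j-th
column of Z, and a nonzero entry of row i of Z makes the i-th one at least m. *)
Lemma gap_cover_crosspolytope (R : realType) n (A : 'M[int]_n)
    (b : 'cV[R]_n) m :
  (0 < m)%N ->
  crosspolytope R n m `&` int_points R n `<=` gap A b ->
  forall i, m%:R <= b i 0.
Proof.
move=> m0 cover i.
have pre k j : (k <= m)%N -> exists2 w : 'cV[int]_n,
    A *m w = k%:Z *: delta_mx j 0 & forall l, - b l 0 <= (w l 0)%:~R <= b l 0.
  move=> /(axis_points_crosspolytope R n m k j)/cover[w wb].
  by move=> /map_intr_inj Aw; exists w.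
have [Z AZ] : exists Z, A *m Z = 1%:M.
  have /fin_all_exists2[w Aw _] j := pre 1%N j m0.
  exists (\matrix_(l, j) w j l 0); apply/matrixP => l j.
  have /matrixP/(_ l 0) := Aw j.
  rewrite !mxE eqxx andbT [RHS]mul1r => <-.
  by apply: eq_bigr => p _; rewrite !mxE.
have ZA := mulmx1C AZ.
have [j Zij] : exists j, Z i j != 0.
  apply: row_neq0; have := congr1 determinant ZA.
  rewrite det_mulmx det1; apply: contra_eq_neq => ->.
  by rewrite mul0r eq_sym oner_eq0.
have [w Aw wb] := pre m j (leqnn m).
have wE : w i 0 = m%:Z * Z i j.
  rewrite -[w]mul1mx -ZA -mulmxA Aw -scalemxAr mxE; congr (_ * _).
  rewrite mxE (bigD1 j)//= big1 => [|p /negbTE pj]; rewrite mxE.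
    by rewrite !eqxx mulr1 addr0.
  by rewrite pj mulr0.
have := wb i; rewrite -ler_norml; apply: le_trans.
rewrite wE intrM normrM -!intr_norm -[leLHS]mulr1.
rewrite ler_pM ?ler0n// -?[m%:R]pmulrn ?ler_nat// -[1]/(1%:~R) ler_int.
by rewrite -gtz0_ge1 normr_gt0.
Qed.

(** All the vectors k eps with eps a sign vector lie in the box of b, so their
images under A have l1-norm at most m; for a good eps it is at least n k. *)
Lemma gap_sub_crosspolytope (R : realType) n (A : 'M[int]_n)
    (b : 'cV[R]_n) m k :
  \det A != 0 -> (forall i, k%:R <= b i 0) ->
  gap A b `<=` crosspolytope R n m -> (n * k <= m)%N.
Proof.
move=> detA kb sub.
have [eps le_n] := exists_signs_norm_ge _ _ detA.
pose x j := \sum_i (-1) ^+ eps i * A j i.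
pose z : 'cV[int]_n := \col_i ((-1) ^+ eps i * k%:Z).
have zE i : `|z i 0| = k%:Z by rewrite mxE normrM normrX normrN1 expr1n mul1r.
have Az j : (A *m z) j 0 = x j * k%:Z.
  rewrite mxE mulr_suml; apply: eq_bigr => i _.
  by rewrite !mxE mulrA [A j i * _]mulrC.
(* The form whose signs are those of x evaluates to the l1-norm. *)
have /sub/(_ [ffun j => x j < 0]) : gap A b (map_mx intr (A *m z)).
  by exists z => // i; rewrite -ler_norml -intr_norm zE.
rewrite (eq_bigr (fun j => (`|x j| * k%:Z)%:~R)) => [|j _].
  rewrite -rmorph_sum -mulr_suml -intr_norm /= pmulrn ler_int.
  rewrite ger0_norm ?mulr_ge0 ?sumr_ge0// => le_m.
  rewrite -lez_nat PoszM; apply: le_trans le_m.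
  by rewrite ler_wpM2r// -[n%:Z]natz.
by rewrite mxE Az /sign_form ffunE normrEsign -mulrA [RHS]intrM intr_sign.
Qed.

(** The inequality n floor (m / tau) <= m for all m; the limit m -> oo removes the
rounding. *)
Lemma crosspolytope_gap_bound (R : realType) n (tau : R) : 0 < tau ->
  (forall m, (0 < m)%N -> exists (A : 'M[int]_n) (b : 'cV[R]_n),
    [/\ gap_params A b, gap A b `<=` crosspolytope R n m &
        crosspolytope R n m `&` int_points R n `<=` gap A (tau *: b)]) ->
  n%:R <= tau.
Proof.
move=> tau0 covers; rewrite leNgt; apply/negP => lt_n.
have gap0 : 0 < n%:R - tau by rewrite subr_gt0.
(* If tau < n, then n (m / tau - 1) < m fails as soon as m exceeds this bound. *)
pose m := (Num.truncn (n%:R * tau / (n%:R - tau))).+1.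
have m_gt : n%:R * tau < m%:R * (n%:R - tau).
  by rewrite -ltr_pdivrMr// truncnS_gt.
have [A [b [[detA b0] sub cover]]] := covers m isT.
have mb i : m%:R / tau <= b i 0.
  rewrite ler_pdivrMr// mulrC.
  by have := gap_cover_crosspolytope R n A _ m isT cover i; rewrite mxE.
pose k := Num.truncn (m%:R / tau).
have kb i : k%:R <= b i 0.
  by apply: le_trans (mb i); rewrite truncn_le divr_ge0// ltW.
have := gap_sub_crosspolytope R n A b m k detA kb sub.
rewrite -(ler_nat R) natrM => nk.
have : m%:R < k.+1%:R * tau by rewrite -ltr_pdivrMr// truncnS_gt.
rewrite -natr1 => mk.
have : n%:R * m%:R < n%:R * (k%:R + 1) * tau.
  rewrite -mulrA ltr_pM2l//; exact: lt_trans lt_n.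
nra.
Qed.

(** * Progressions in a sheared cube *)

(** The point (v_0, v_1, ...) of height v_0 in [-1, 1] belongs to the convex hull of
{1} x {0, 1}^n and its reflection when (v_0 - 1) / 2 <= v_i <= (v_0 + 1) / 2 for
i > 0, that is when these forms are at most 1 in absolute value.  For i = 0 the
form is v_0 itself, so the index 0 needs no separate treatment. *)
Definition skew_form (R : realType) n (i k : 'I_n.+1) : R :=
  2 * (k == i)%:R - (k == 0)%:R.

Definition skew_cube (R : realType) n : set 'cV[R]_n.+1 :=
  polytope (@skew_form R n) 1.

Lemma skew_cubeE (R : realType) n (v : 'cV[R]_n.+1) :
  skew_cube R n v <-> forall i, `|2 * v i 0 - v 0 0| <= 1.
Proof.
suff formE i : \sum_k skew_form R n i k * v k 0 = 2 * v i 0 - v 0 0.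
  by split=> Kv i; have := Kv i; rewrite formE.
rewrite (eq_bigr (fun k => 2 * ((k == i)%:R * v k 0) - (k == 0)%:R * v k 0)).
  rewrite sumrB -mulr_sumr; congr (2 * _ - _).
    rewrite (bigD1 i)//= eqxx mul1r big1 ?addr0// => k /negbTE->.
    by rewrite mul0r.
  rewrite (bigD1 0)//= mul1r big1 ?addr0// => k /negbTE->.
  by rewrite mul0r.
by move=> k _; rewrite /skew_form mulrBl mulrA.
Qed.

Lemma skew_cube_sym_convex_body (R : realType) n :
  sym_convex_body (skew_cube R n).
Proof.
apply: (@polytope_sym_convex_body _ _ _ _ _ 1) => // v /skew_cubeE Kv i.
by have := Kv 0; have := Kv i; rewrite !ler_norml => /andP[? ?] /andP[? ?]; lra.
Qed.

Lemma skew_cube_intP (R : realType) n (x : 'cV[int]_n.+1) :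
  skew_cube R n (map_mx intr x) <-> forall i, `|2 * x i 0 - x 0 0| <= 1.
Proof.
have castE i : `|2 * (map_mx intr x : 'cV[R]_n.+1) i 0 - map_mx intr x 0 0|
    = `|2 * x i 0 - x 0 0|%:~R.
  by rewrite !mxE intr_norm intrB intrM.
split=> [/skew_cubeE Kx i|Kx]; first by have := Kx i; rewrite castE -(ler_int R).
by apply/skew_cubeE => i; have := Kx i; rewrite castE -(ler_int R).
Qed.

(** The vertices are the solutions of 2 v_i - v_0 = 2 s_i - 1 with s_i in {0, 1};
taking i = 0 gives v_0 = 2 s_0 - 1, whence the formula.  [None] stands for the
origin. *)
Definition skew_cube_point n (s : option {ffun 'I_n.+1 -> bool}) :
    'cV[int]_n.+1 :=
  if s is Some s then \col_i ((s i : nat)%:Z + (s 0 : nat)%:Z - 1) else 0.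

Lemma skew_cube_point_inj n : injective (@skew_cube_point n).
Proof.
have entry (s : {ffun 'I_n.+1 -> bool}) i :
    skew_cube_point n (Some s) i 0 = (s i : nat)%:Z + (s 0 : nat)%:Z - 1.
  by rewrite mxE.
have entry0 i : skew_cube_point n None i 0 = 0 by rewrite mxE.
move=> [s|] [t|] // st; have st_ i := congr1 (fun x : 'cV_n.+1 => x i 0) st.
- congr Some; apply/ffunP => i.
  have := st_ i; have := st_ 0; rewrite !entry.
  by case: (s i) (t i) (s 0) (t 0) => [] [] [] [].
- by have := st_ 0; rewrite entry entry0; case: (s 0).
- by have := st_ 0; rewrite entry entry0; case: (t 0).
Qed.

(** At height 0 the constraints |2 x_i| <= 1 leave only the origin; at height 1 or
-1 the odd integers 2 x_i - x_0 are 1 or -1. *)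
Lemma skew_cube_int_points (R : realType) n :
  skew_cube R n `&` int_points R n.+1 =
  [set map_mx intr (skew_cube_point n s) | s in setT].
Proof.
apply/seteqP; split=> [_ [/[swap] [[x _ <-]] /skew_cube_intP Kx]|_ [s _ <-]].
  have x0 := Kx 0.
  have [x00|x00] := eqVneq (x 0 0) 0.
    exists None => //; congr map_mx; apply/matrixP => i j.
    rewrite ord1 mxE; have := Kx i; lia.
  exists (Some [ffun i => 2 * x i 0 - x 0 0 == 1]) => //.
  congr map_mx; apply/matrixP => i j; rewrite ord1 !mxE !ffunE.
  have := Kx i.
  case: (eqVneq (2 * x i 0 - x 0 0) 1);
    case: (eqVneq (2 * x 0 0 - x 0 0) 1) => /=; lia.
split; last by exists (skew_cube_point n s).
apply/skew_cube_intP => i; case: s => [s|]; last by rewrite !mxE.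
by rewrite !mxE; case: (s i); case: (s 0).
Qed.

Lemma card_skew_cube_int_points (R : realType) n :
  card_points (skew_cube R n `&` int_points R n.+1) = (2 ^ n.+1 + 1)%N.
Proof.
rewrite /card_points skew_cube_int_points.
rewrite fset_set_image; last exact: finite_finset.
rewrite card_imfset /=; last first.
  by move=> s t /map_intr_inj; exact: skew_cube_point_inj.
have -> : [set: option {ffun 'I_n.+1 -> bool}] =
    [set` [fset x | x in {: option {ffun 'I_n.+1 -> bool}}]%fset].
  by apply/seteqP; split=> x // _ /=; rewrite inE.
rewrite set_fsetK card_imfset//= -cardE.
by rewrite card_option card_ffun card_bool card_ord addn1.
Qed.

Lemma mulmx_eq0_det n (A : 'M[int]_n) (z : 'cV[int]_n) :
  \det A != 0 -> A *m z = 0 -> z = 0.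
Proof.
move=> detA Az; have := congr1 (mulmx (\adj A)) Az.
rewrite mulmxA mul_adj_mx mulmx0 mul_scalar_mx => /eqP.
by rewrite scalemx_eq0 (negbTE detA) => /eqP.
Qed.

(** Heights of lattice points of the body are 0, 1 or -1, and only the origin has
height 0.  So the heights h_i of the columns of A with b_i >= 1 are 1 or -1; if
there were two of them, h_i + h_j or h_i - h_j would be 2 or -2, and b_i >= 2
would allow the height 2 h_i.  At most one coordinate of the box is thus not
identically 0, and it takes its values in {0, 1, -1}. *)
Lemma card_gap_skew_cube (R : realType) n (A : 'M[int]_n.+1)
    (b : 'cV[R]_n.+1) :
  gap_params A b -> gap A b `<=` skew_cube R n ->
  (card_points (gap A b) <= 3)%N.
Proof.
move=> [detA b_gt0] sub.
pose box (z : 'cV[int]_n.+1) := forall i, - b i 0 <= (z i 0)%:~R <= b i 0.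
have boxK z : box z -> forall i, `|2 * (A *m z) i 0 - (A *m z) 0 0| <= 1.
  by move=> bz; apply/(@skew_cube_intP R)/sub; exists z.
have box_eq0 z : box z -> (A *m z) 0 0 = 0 -> z = 0.
  move=> /boxK Kz z0; apply: mulmx_eq0_det detA _.
  by apply/matrixP => i j; rewrite ord1 [RHS]mxE; have := Kz i; lia.
have box_le1 z : box z -> `|(A *m z) 0 0| <= 1.
  by move=> /boxK/(_ 0); lia.
pose e (i : 'I_n.+1) : 'cV[int]_n.+1 := delta_mx i 0.
have eE i k : e i k 0 = (k == i)%:R by rewrite mxE eqxx andbT.
have e_neq0 i : e i <> 0.
  by move/matrixP/(_ i 0); rewrite eE eqxx mxE.
have Ae_neq0 i : 1 <= b i 0 -> (A *m e i) 0 0 != 0.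
  move=> bi; apply: contra_notN (e_neq0 i) => /eqP; apply: box_eq0 => k.
  by rewrite -ler_norml -intr_norm eE; case: eqVneq => [->//|_]; exact: ltW.
have box_e (x : int) i : `|x|%:~R <= b i 0 -> box (x *: e i).
  move=> xb k; rewrite -ler_norml -intr_norm mxE eE.
  by case: eqVneq => [->|_]; rewrite ?mulr1// mulr0 normr0 ltW.
have lt2 i : b i 0 < 2.
  rewrite ltNge; apply/negP => bi.
  have := box_le1 _ (box_e 2 i bi); rewrite -scalemxAr mxE.
  have : (A *m e i) 0 0 != 0.
    by apply: Ae_neq0; apply: le_trans bi; rewrite ler1n.
  by move: ((A *m e i) 0 0) => t; lia.
have one i j : 1 <= b i 0 -> 1 <= b j 0 -> i = j.
  move=> bi bj; apply/eqP/negPn/negP => ij.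
  have box_ij x : `|x| = 1 -> box (e i + x *: e j).
    move=> x1 k; rewrite -ler_norml -intr_norm mxE [X in _ + X]mxE !eE.
    case: (eqVneq k i) => [->|_]; first by rewrite (negbTE ij) mulr0 addr0.
    by case: eqVneq => [->|_]; rewrite add0r ?mulr1 ?x1// mulr0 normr0 ltW.
  have := box_le1 _ (box_ij 1 erefl); have := box_le1 _ (box_ij (-1) erefl).
  have combE x :
      (A *m (e i + x *: e j)) 0 0 = (A *m e i) 0 0 + x * (A *m e j) 0 0.
    by rewrite mulmxDr -scalemxAr mxE; congr (_ + _); rewrite mxE.
  rewrite !combE.
  have := Ae_neq0 i bi; have := Ae_neq0 j bj.
  by move: ((A *m e i) 0 0) ((A *m e j) 0 0) => s t; lia.
have [i big_i] : exists i, forall k, k != i -> b k 0 < 1.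
  have [/existsP[i bi]|/existsPn small] := boolP [exists i, 1 <= b i 0].
    by exists i => k; rewrite ltNge; apply: contra_neqN => /one; apply.
  (* No coordinate of the box is free, and any index will do. *)
  by exists 0 => k _; rewrite ltNge small.
pose F := [fset (map_mx intr (A *m (x *: e i)) : 'cV[R]_n.+1) |
            x in [:: 0; 1; -1 : int]]%fset.
have gapF : gap A b `<=` [set` F].
  move=> _ [z bz <-].
  have small k x : b k 0 < x%:~R -> `|z k 0| < x.
    by move=> bx; rewrite -(ltr_int R) intr_norm (le_lt_trans _ bx)// ler_norml.
  apply/imfsetP; exists (z i 0) => /=.
    rewrite !inE; have := small i 2 (lt2 i).
    by case: (z i 0) => [[|[|k]]|[|k]].
  congr (map_mx _ (_ *m _)); apply/matrixP => k l; rewrite ord1 [RHS]mxE eE.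
  case: eqVneq => [->|ki]; first by rewrite mulr1.
  have := small k 1 (big_i k ki); rewrite mulr0.
  by case: (z k 0) => [[|p]|p].
rewrite /card_points (@leq_trans #|` F|)//.
  rewrite fsubset_leq_card// -[F]set_fsetK -fset_set_sub//.
  exact: sub_finite_set gapF _.
by rewrite (leq_trans (leq_imfset_card _ _ _)).
Qed.

Lemma skew_cube_gap_bound (R : realType) n (nu : R) : 0 < nu ->
  (exists (A : 'M[int]_n.+1) (b : 'cV[R]_n.+1),
    [/\ gap_params A b, gap A b `<=` skew_cube R n &
        (card_points (skew_cube R n `&` int_points R n.+1))%:R
          <= nu * (card_points (gap A b))%:R]) ->
  (2 ^+ n.+1 + 1) / 3 <= nu.
Proof.
move=> nu0 [A [b [Ab sub]]].
rewrite card_skew_cube_int_points natrD natrX => count.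
rewrite ler_pdivrMr// (le_trans count)// ler_wpM2l//; first exact: ltW.
by have := @card_gap_skew_cube R n A b Ab sub; rewrite -(ler_nat R).
Qed.

Theorem proposition3p4 (R : realType) (n : nat) (n_ge1 : (1 <= n)%N) :
  (forall tau : R, 0 < tau ->
     (forall K : set 'cV[R]_n, sym_convex_body K ->
        exists (A : 'M[int]_n) (b : 'cV[R]_n),
          [/\ gap_params A b,
              gap A b `<=` K &
              K `&` int_points R n `<=` gap A (tau *: b)]) ->
     (n`!%:R `^ (n%:R^-1) <= tau) /\
     ((expR 1)^-1 * n%:R < (n`!%:R : R) `^ (n%:R^-1)))
  /\
  (forall nu : R, 0 < nu ->
     (forall K : set 'cV[R]_n, sym_convex_body K ->
        exists (A : 'M[int]_n) (b : 'cV[R]_n),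
          [/\ gap_params A b,
              gap A b `<=` K &
              (card_points (K `&` int_points R n))%:R
                <= nu * (card_points (gap A b))%:R]) ->
     (2 ^+ n + 1) / 3 <= nu).
Proof.
split=> [tau tau0 covers|nu nu0 counts].
  split; last exact: lt_root_fact.
  apply: le_trans (@root_fact_le R n n_ge1) _.
  apply: crosspolytope_gap_bound tau0 _ => m m0.
  exact/covers/crosspolytope_sym_convex_body.
case: n n_ge1 counts => // n _ counts.
apply: skew_cube_gap_bound nu0 _.
exact/counts/skew_cube_sym_convex_body.
Qed.
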